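(* For every positive integer $k$ there exists $n_0(k)$ such that the following holds for all integers $n \ge n_0(k)$. Let $L$ be a non-empty proper subset of $\{0,1,\ldots,k-1\}$. If $$\alpha(J(n,k,L)) \cdot \omega(J(n,k,L)) = \binom{n}{k},$$ then there exists an integer $t$ such that either $L$ or $\{0,\ldots,k-1\}\setminus L$ is equal to $\{0,1,\ldots,t-1\}$.
   Context: For integers $n,k$ and a set $L \subset \{0,1,\ldots,k-1\}$, the generalized Johnson graph $J(n,k,L)$ is the simple graph whose vertex set is $\binom{[n]}{k}$, the collection of all $k$-element subsets of $[n]=\{1,\ldots,n\}$, in which two distinct vertices $F_1,F_2$ are adjacent if and only if $|F_1\cap F_2|\in L$. For a graph $G$, $\omega(G)$ denotes the size of a largest clique in $G$, and $\alpha(G)$ denotes the size of a largest coclique (independent set) in $G$. *)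

(* Defs.v *)
From mathcomp Require Import all_boot.

Set Implicit Arguments.
Unset Strict Implicit.
Unset Printing Implicit Defensive.

(* A simple graph on a finite type is given by its adjacency relation. *)
Section Graphs.

Variables (T : finType) (e : rel T).

Definition clique (A : {set T}) : bool :=
  [forall x in A, forall y in A, (x != y) ==> e x y].

Definition coclique (A : {set T}) : bool :=
  [forall x in A, forall y in A, (x != y) ==> ~~ e x y].

Definition omega : nat := \max_(A : {set T} | clique A) #|A|.

Definition alpha : nat := \max_(A : {set T} | coclique A) #|A|.

End Graphs.

(* The ground set [n] is 'I_n (labelled from 0), and the set L of intersection
   sizes, a subset of {0, ..., k-1}, is a {set 'I_k}. *)
Definition johnson (n k : nat) (L : {set 'I_k}) :
    rel {F : {set 'I_n} | #|F| == k} :=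
  fun F1 F2 =>
    (F1 != F2) && [exists l in L, #|val F1 :&: val F2| == val l].

Arguments johnson : clear implicits.

Lemma johnson_irrefl n k L : irreflexive (johnson n k L).
Proof. by move=> F; rewrite /johnson eqxx. Qed.

Lemma johnson_sym n k L : symmetric (johnson n k L).
Proof. by move=> F1 F2; rewrite /johnson eq_sym setIC. Qed.

(* Main.v *)
(** Let A be whichever of L and its complement contains k - 1, and let B be the
    other one.  A uniform family with at most m intersection sizes
    has O(n^m) members, so families with sizes in B number O(n^(k - |A|)).  If A
    is not a final segment of {0, ..., k - 1}, then families with sizes in A
    have only O(n^(|A| - 1)) members; the product is then O(n^(k - 1)), smaller
    than 'C(n, k) for large n.

    By passing to the members through a point, the second bound reduces to the
    case where intersections are exactly a common set W or have size at least t
    with |W| + 1 < t < k.  A point x is bad if the members through x meet in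
    fewer than t points; members through bad points number O(n^(k - t)).  The
    other members are unions of closures (intersections of all members through
    a point), each of size at least t, hence are generated by k - t points. *)

Require Import Defs.
From mathcomp Require Import all_boot.
From mathcomp Require Import zify.

Set Implicit Arguments.
Unset Strict Implicit.
Unset Printing Implicit Defensive.

(** * Finite sets: intermediate cardinalities and a union bound *)

Lemma subset_card_between (T : finType) (A B : {set T}) (m : nat) :
  A \subset B -> #|A| <= m <= #|B| ->
  exists C : {set T}, [/\ A \subset C, C \subset B & #|C| = m].
Proof.
move=> sAB /andP[]; elim: m => [|m IHm] leAm lemB.
  by exists A; split=> //; apply/eqP; rewrite -leqn0.
have [eqA|ltAm] := leqP #|A| m; last by exists A; split=> //; lia.
have [C [sAC sCB cardC]] := IHm eqA (ltnW lemB).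
have /properP[_ [x xB xC]] : C \proper B by rewrite properEcard sCB cardC.
exists (x |: C); split; last by rewrite cardsU1 xC cardC.
  exact: subset_trans (subsetUr _ _).
by rewrite subUset sub1set xB.
Qed.

Lemma leq_card_bigcup (I T : finType) (A : {set I}) (H : I -> {set T})
    (G : {set T}) (b : nat) :
  (forall F, F \in G -> exists2 i, i \in A & F \in H i) ->
  (forall i, i \in A -> #|H i| <= b) -> #|G| <= #|A| * b.
Proof.
move=> cov leb; rewrite -sum_nat_const.
apply: leq_trans (_ : \sum_(i in A) #|H i| <= _); last exact: leq_sum.
apply: leq_trans (_ : #|\bigcup_(i in A) H i| <= _).
  by apply/subset_leq_card/subsetP => F /cov[i iA FHi]; apply/bigcupP; exists i.
apply: (big_ind2 (fun (B : {set T}) m => #|B| <= m)) => //.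
  by rewrite cards0.
move=> B1 m1 B2 m2 le1 le2; apply: leq_trans (leq_add le1 le2).
by rewrite cardsU leq_subr.
Qed.

(** * Uniform families with prescribed intersection sizes *)

Section Families.

Variable T : finType.
Implicit Types (G : {set {set T}}) (F W X : {set T}) (P : pred nat).

Definition star G x : {set {set T}} := [set F in G | x \in F].

Definition uniform k G := forall F, F \in G -> #|F| = k.

Definition meets_in P G :=
  forall F1 F2, F1 \in G -> F2 \in G -> F1 != F2 -> P #|F1 :&: F2|.

Lemma star_sub G x F : F \in star G x -> F \in G.
Proof. by rewrite inE => /andP[]. Qed.

Lemma uniform_star k G x : uniform k G -> uniform k (star G x).
Proof. by move=> uG F /star_sub; apply: uG. Qed.

Lemma meets_in_star P G x : meets_in P G -> meets_in P (star G x).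
Proof. by move=> mG F1 F2 /star_sub F1G /star_sub; apply: mG. Qed.

Lemma star_above W G x :
  (forall F, F \in G -> W \subset F) ->
  forall F, F \in star G x -> x |: W \subset F.
Proof.
by move=> sWG F; rewrite inE => /andP[FG xF]; rewrite subUset sub1set xF sWG.
Qed.

Lemma card_le1 (k : nat) G W :
  uniform k G -> (forall F, F \in G -> W \subset F) -> k <= #|W| -> #|G| <= 1.
Proof.
move=> uG sWG lekW; rewrite -(cards1 W); apply/subset_leq_card/subsetP => F FG.
by rewrite inE eq_sym eqEcard sWG // uG.
Qed.

Lemma count_iotaS P w d :
  count P (iota w d.+1) = P w + count P (iota w.+1 d).
Proof. by []. Qed.

Lemma exists_outside k G W F :
  uniform k G -> F \in G -> #|W| < k -> exists2 x, x \in ~: W & x \in F.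
Proof.
move=> uG FG ltWk; have /subsetPn[x xF xW]: ~~ (F \subset W).
  by apply: contraL ltWk => /subset_leq_card; rewrite uG // -leqNgt.
by exists x => //; rewrite inE.
Qed.

(** The intersection of two distinct members contains [W] and cannot have the forbidden size [#|W|],
    so it is strictly larger than [W]. *)
Lemma exists_common_outside k P G W F0 F :
    uniform k G -> (forall F, F \in G -> W \subset F) -> meets_in P G ->
    #|W| < k -> ~~ P #|W| -> F0 \in G -> F \in G ->
  exists2 x, x \in F0 :\: W & x \in F.
Proof.
move=> uG sWG mG ltWk nPW F0G FG.
have [->|neF] := eqVneq F F0.
  have [x xW xF0] := exists_outside uG F0G ltWk.
  by exists x => //; rewrite inE xF0 andbT -in_setC.
have sWI : W \subset F :&: F0 by rewrite subsetI !sWG.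
have /properP[_ [x /setIP[xF xF0] xW]] : W \proper F :&: F0.
  rewrite properE sWI /=; apply: contra nPW => sIW.
  have -> : W = F :&: F0 by apply/eqP; rewrite eqEsubset sWI sIW.
  exact: mG.
by exists x => //; rewrite inE xW.
Qed.

Lemma cardsU1C x W : x \in ~: W -> #|x |: W| = #|W|.+1.
Proof. by rewrite inE => xW; rewrite cardsU1 xW. Qed.

(** Induction on [k - #|W|], enlarging the common part [W] by one point of each member. The new
    point ranges over a fixed member when the size [#|W|] is forbidden, and over the whole ground
    set when it is allowed; hence one power of [#|T|] per allowed size. *)
Lemma family_bound k P G W :
    uniform k G -> (forall F, F \in G -> W \subset F) -> meets_in P G ->
  #|G| <= k ^ (k - #|W|) * #|T| ^ count P (iota #|W| (k - #|W|)).
Proof.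
move: {2}(k - _) (erefl (k - #|W|)) => d.
elim: d W G => [|d IHd] W G def_d uG sWG mG; rewrite def_d.
  by apply: card_le1 uG sWG _; lia.
have ltWk : #|W| < k by lia.
have bstar x : x \in ~: W ->
    #|star G x| <= k ^ d * #|T| ^ count P (iota #|W|.+1 d).
  move=> xW; have := IHd (x |: W) (star G x); rewrite cardsU1C //.
  have -> : k - #|W|.+1 = d by lia.
  by apply; [|exact: uniform_star|exact: star_above|exact: meets_in_star].
rewrite count_iotaS; case: (boolP (P #|W|)) => [PW|nPW]; last first.
  have [->|[F0 F0G]] := set_0Vmem G; first by rewrite cards0.
  apply: leq_trans (leq_card_bigcup (A := F0 :\: W) (H := star G) _ _) _.
  - move=> F FG.
    have [x xF0 xF] := exists_common_outside uG sWG mG ltWk nPW F0G FG.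
    by exists x => //; rewrite inE FG.
  - by move=> x /setDP[_ xW]; apply: bstar; rewrite inE.
  rewrite add0n expnS -mulnA leq_mul2r; apply/orP; right.
  by rewrite -(uG _ F0G) subset_leq_card // subsetDl.
apply: leq_trans (leq_card_bigcup (A := ~: W) (H := star G) _ bstar) _.
  move=> F FG; have [x xW xF] := exists_outside uG FG ltWk.
  by exists x => //; rewrite inE FG.
(* Only [#|T|] is needed here; the extra factor [k] keeps the constant the same in both cases. *)
rewrite add1n !expnS mulnACA leq_mul2r; apply/orP; right.
apply: leq_trans (max_card _) _.
by rewrite leq_pmull //; lia.
Qed.

Lemma card_above k G W :
  uniform k G -> (forall F, F \in G -> W \subset F) ->
  #|G| <= k ^ (k - #|W|) * #|T| ^ (k - #|W|).
Proof.
move=> uG sWG; have := family_bound (P := predT) uG sWG (fun _ _ _ _ _ => isT).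
by rewrite count_predT size_iota.
Qed.

(** Each member contains one of at most [2 ^ k] [t]-subsets [U] of a fixed member. As [U] is too
    large to lie in all members, some member misses part of it and supplies at most [k] candidates
    for one more point, which saves a power of [#|T|]. *)
Lemma nontrivial_intersecting_bound k t G :
    uniform k G -> meets_in (leq t) G -> t < k ->
    #|\bigcap_(F in G) F| < t ->
  #|G| <= 2 ^ k * k * k ^ k * #|T| ^ (k - t.+1).
Proof.
move=> uG mG ltk ltcap.
have [->|[F0 F0G]] := set_0Vmem G; first by rewrite cards0.
pose A := [set U : {set T} | (U \subset F0) && (#|U| == t)].
pose H (U : {set T}) := [set F in G | U \subset F].
have leA : #|A| <= 2 ^ k.
  rewrite -(uG _ F0G) -card_powerset; apply/subset_leq_card/subsetP => U.
  by rewrite !inE => /andP[].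
have covA F : F \in G -> exists2 U, U \in A & F \in H U.
  move=> FG; have leI : t <= #|F :&: F0|.
    have [->|neF] := eqVneq F F0; first by rewrite setIid uG //; exact: ltnW.
    exact: mG.
  have [|U [_ sUI cardU]] :=
    @subset_card_between T set0 (F :&: F0) t (sub0set _).
    by rewrite cards0 leI.
  move: sUI; rewrite subsetI => /andP[sUF sUF0].
  by exists U; rewrite inE ?sUF0 ?cardU ?eqxx // FG.
have bH U : U \in A -> #|H U| <= k * (k ^ k * #|T| ^ (k - t.+1)).
  rewrite inE => /andP[sUF0 /eqP cardU].
  have /subsetPn[z zU /bigcapP zcap] : ~~ (U \subset \bigcap_(F in G) F).
    by apply: contraL ltcap => /subset_leq_card; rewrite cardU -leqNgt.
  have /existsP[F1 /andP[F1G zF1]] : [exists F in G, z \notin F].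
    apply: contraT; rewrite negb_exists => /forallP nex; case: zcap => F FG.
    by have := nex F; rewrite FG negbK.
  (* F meets F1 in t points, hence outside U: F contains t.+1 known points. *)
  have uH : uniform k (H U) by move=> F; rewrite inE => /andP[/uG].
  set b := k ^ k * _.
  apply: leq_trans
    (leq_card_bigcup (A := F1 :\: U) (H := star (H U)) (b := b) _ _) _.
  - move=> F FH; have := FH; rewrite inE => /andP[FG sUF].
    have neF : F != F1 by apply: contraNneq zF1 => <-; apply: (subsetP sUF).
    have /subsetPn[y yI yU] : ~~ (F :&: F1 \subset U).
      apply: contraL (mG _ _ FG F1G neF) => sIU; rewrite -ltnNge -cardU.
      apply/proper_card/properP; split=> //; exists z => //.
      by rewrite inE (negPf zF1) andbF.
    move: yI; rewrite inE => /andP[yF yF1].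
    by exists y; [rewrite inE yU|rewrite inE FH].
  - move=> y /setDP[_ yU].
    have sH : forall F, F \in star (H U) y -> y |: U \subset F.
      by apply: star_above => F; rewrite inE => /andP[].
    apply: leq_trans (card_above (uniform_star uH) sH) _.
    rewrite cardsU1C ?inE // cardU leq_mul2r leq_pexp2l ?orbT ?leq_subr //.
    exact: leq_ltn_trans ltk.
  rewrite leq_mul2r; apply/orP; right.
  by rewrite -(uG _ F1G) subset_leq_card // subsetDl.
by apply: leq_trans (leq_card_bigcup covA bH) _; rewrite !mulnA -!mulnA leq_mul.
Qed.

(** * Closures of points and generating sets *)

Definition closure G x : {set T} := \bigcap_(F in star G x) F.

Lemma closure_sub G x F : F \in G -> x \in F -> closure G x \subset F.
Proof. by move=> FG xF; apply: bigcap_inf; rewrite inE FG. Qed.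

Lemma closure_sub_closure G x y :
  y \in closure G x -> closure G y \subset closure G x.
Proof.
move=> yx; apply/bigcapsP => F Fx; apply: closure_sub; first exact: star_sub Fx.
exact: (subsetP (bigcap_inf F Fx)).
Qed.

Lemma mem_closure G x : x \in closure G x.
Proof. by apply/bigcapP => F; rewrite inE => /andP[]. Qed.

Lemma sub_closure W G x :
  (forall F, F \in G -> W \subset F) -> W \subset closure G x.
Proof. by move=> sWG; apply/bigcapsP => F /star_sub; apply: sWG. Qed.

Lemma generating_subset k t G W F :
    uniform k G -> (forall F, F \in G -> W \subset F) ->
    #|W|.+1 < t < k -> F \in G ->
    (forall x, x \in F :\: W -> t <= #|closure G x|) ->
  exists2 S : {set T}, #|S| = k - t & \bigcup_(x in S) closure G x = F.
Proof.
move=> uG sWG /andP[ltWt ltk] FG good.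
(* At most [k - t] generators suffice: adding further points of [F] keeps the union inside [F]. *)
suff [S [sSF leS sFS]] : exists S : {set T},
    [/\ S \subset F, #|S| <= k - t & F \subset \bigcup_(x in S) closure G x].
  have [|S' [sSS' sS'F cardS']] := @subset_card_between T S F (k - t) sSF.
    by rewrite leS uG // leq_subr.
  exists S' => //; apply/eqP; rewrite eqEsubset; apply/andP; split.
    by apply/bigcupsP => x xS'; apply: closure_sub => //; apply: (subsetP sS'F).
  apply: subset_trans sFS _; apply/bigcupsP => x xS.
  exact: bigcup_sup (subsetP sSS' x xS).
have cardF : #|F| = k := uG F FG.
case: (boolP [exists x in F :\: W, t < #|closure G x|]) => [|/existsPn small].
  case/existsP => x /andP[/setDP[xF xW] lttx].
  exists (F :\: (closure G x :\ x)); split; first exact: subsetDl.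
    have sub : closure G x :\ x \subset F.
      by apply: subset_trans (subsetDl _ _) (closure_sub FG xF).
    have := cardsD1 x (closure G x); rewrite mem_closure => cardx.
    by have := cardsDS sub; lia.
  apply/subsetP => y yF; apply/bigcupP.
  have [yx|yx] := boolP (y \in closure G x :\ x).
    by exists x; [rewrite !inE eqxx | case/setDP: yx].
  by exists y; [rewrite inE yx | exact: mem_closure].
have cardcl x : x \in F :\: W -> #|closure G x| = t.
  by move=> xFW; have := good x xFW; have := small x; rewrite xFW /=; lia.
have ltWk : #|W| < k by lia.
have [x xW xF] := exists_outside uG FG ltWk.
have xFW : x \in F :\: W by rewrite inE xF andbT -in_setC.
have [y yx yF] : exists2 y, y \in ~: closure G x & y \in F.
  by apply: exists_outside uG FG _; rewrite cardcl.
have yFW : y \in F :\: W.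
  rewrite inE yF andbT; apply: contraL yx => yW; rewrite inE negbK.
  exact: (subsetP (sub_closure x sWG)).
have eqI : closure G x :&: closure G y = W.
  apply/eqP; rewrite eqEsubset subsetI !sub_closure // !andbT.
  apply/subsetP => z /setIP[zx zy]; apply: contraLR yx => zW.
  have zFW : z \in F :\: W.
    by rewrite inE zW (subsetP (closure_sub FG xF)).
  (* Closures of equal size are equal once nested, so a point outside [W] shared by two of them
     would identify them. *)
  have eqcl u : u \in F :\: W -> z \in closure G u -> closure G z = closure G u.
    move=> uFW zu; apply/eqP.
    by rewrite eqEcard closure_sub_closure //= (cardcl u) // (cardcl z).
  by rewrite inE negbK -(eqcl x) // (eqcl y) // mem_closure.
(* Two closures meeting only in W together save 2 t - #|W| - 2 >= t points. *)
pose D := (closure G x :|: closure G y) :\: [set x; y].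
exists (F :\: D); split; first exact: subsetDl.
  have neq : x != y.
    by apply: contraTneq yx => <-; rewrite inE negbK mem_closure.
  have sDU : [set x; y] \subset closure G x :|: closure G y.
    by rewrite subUset !sub1set !inE !mem_closure orbT.
  have sUF : closure G x :|: closure G y \subset F.
    by rewrite subUset !closure_sub.
  have := cardsDS (subset_trans (subsetDl _ [set x; y]) sUF).
  have := subset_leq_card sUF.
  rewrite /D (cardsDS sDU) cards2 neq cardsU eqI !cardcl // cardF; lia.
apply/subsetP => z zF; apply/bigcupP.
have [|zD] := boolP (z \in D); last first.
  by exists z; [rewrite inE zD | exact: mem_closure].
rewrite !inE negb_or => /andP[_ /orP[zx|zy]].
  by exists x; rewrite // !inE eqxx.
by exists y; rewrite // !inE eqxx orbT.
Qed.

(** * Families whose allowed sizes have a gap *)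

Lemma card_subsets_bound m :
  #|[set S : {set T} | #|S| == m]| <= m ^ m * #|T| ^ m.
Proof.
have um : uniform m [set S : {set T} | #|S| == m].
  by move=> S; rewrite inE => /eqP.
by have := card_above um (fun S _ => sub0set S); rewrite cards0 subn0.
Qed.

(** The first term pays for the members generated by [k - t] points, the second for those through a
    bad point. *)
Definition gap_const (k : nat) := k ^ k + 2 ^ k * k * k ^ k.

Lemma isolated_intersection_bound k t G W :
    uniform k G -> (forall F, F \in G -> W \subset F) ->
    #|W|.+1 < t < k ->
    meets_in (fun i => (i == #|W|) || (t <= i)) G ->
  #|G| <= gap_const k * #|T| ^ (k - t).
Proof.
move=> uG sWG lt_t_k mG; have /andP[ltWt ltk] := lt_t_k.
pose bad := [set x in ~: W | #|closure G x| < t].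
pose Gbad := [set F in G | [exists x in bad, x \in F]].
have bstar x : x \in bad ->
    #|star G x| <= 2 ^ k * k * k ^ k * #|T| ^ (k - t.+1).
  rewrite inE => /andP[xW ltcl].
  apply: nontrivial_intersecting_bound ltk ltcl; first exact: uniform_star.
  move=> F1 F2 F1x F2x neF.
  have := meets_in_star mG F1x F2x neF => /orP[/eqP cardI|//].
  (* Two members through [x] share [#|W|.+1] points, which rules out the isolated size [#|W|]. *)
  have : #|x |: W| <= #|F1 :&: F2|.
    by rewrite subset_leq_card // subsetI !(star_above sWG).
  by rewrite cardI cardsU1C // ltnn.
have leGbad : #|Gbad| <= 2 ^ k * k * k ^ k * #|T| ^ (k - t).
  have covbad F : F \in Gbad -> exists2 x, x \in bad & F \in star G x.
    rewrite inE => /andP[FG /existsP[x /andP[xbad xF]]].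
    by exists x => //; rewrite inE FG.
  apply: leq_trans (leq_card_bigcup covbad bstar) _.
  (* The power of [#|T|] saved in each star pays for the choice of the bad point. *)
  rewrite (_ : k - t = (k - t.+1).+1); last by lia.
  by rewrite expnS [X in _ <= X]mulnCA leq_mul2r max_card orbT.
have leGgood : #|G :\: Gbad| <= k ^ k * #|T| ^ (k - t).
  apply: leq_trans (_ : (k - t) ^ (k - t) * #|T| ^ (k - t) <= _).
    apply: leq_trans (card_subsets_bound (k - t)).
    pose hull (S : {set T}) := \bigcup_(x in S) closure G x.
    apply: leq_trans (leq_imset_card hull _).
    apply/subset_leq_card/subsetP => F; rewrite !inE => /andP[nFbad FG].
    have [x xFW|S cardS hullS] := generating_subset uG sWG lt_t_k FG.
      rewrite leqNgt; apply: contra nFbad => ltcl; rewrite FG.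
      case/setDP: xFW => xF xW.
      by apply/existsP; exists x; rewrite !inE xW ltcl.
    by apply/imsetP; exists S; rewrite ?inE ?cardS.
  rewrite leq_mul2r; apply/orP; right.
  have ltk0 : 0 < k by lia.
  apply: leq_trans (leq_pexp2l ltk0 (leq_subr t k)).
  by rewrite leq_exp2r ?subn_gt0 // leq_subr.
rewrite -(cardsID Gbad G) mulnDl addnC leq_add //.
by apply: leq_trans leGbad; rewrite subset_leq_card // subsetIr.
Qed.

(** The induction of [family_bound], run as long as the sizes above [#|W|] still contain a gap, an
    allowed size below a forbidden one. When passing to a star would lose the gap, [#|W|] is
    isolated below a final segment of allowed sizes, and [isolated_intersection_bound] saves the
    power. *)
Lemma gap_bound k P G W :
    uniform k G -> (forall F, F \in G -> W \subset F) -> meets_in P G ->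
    P k.-1 ->
    (exists2 a, #|W| <= a /\ P a & exists2 b, a < b < k & ~~ P b) ->
  #|G| <= k ^ (k - #|W|) * gap_const k
            * #|T| ^ (count P (iota #|W| (k - #|W|))).-1.
Proof.
move: {2}(k - _) (erefl (k - #|W|)) => d.
elim: d W G => [|d IHd] W G def_d uG sWG mG Pk [a [leWa Pa] [b ltabk nPb]].
  by lia.
rewrite def_d.
have ltWk : #|W| < k by lia.
have bstar x : x \in ~: W ->
    (exists2 a, #|W| < a /\ P a & exists2 b, a < b < k & ~~ P b) ->
    #|star G x| <= k ^ d * gap_const k * #|T| ^ (count P (iota #|W|.+1 d)).-1.
  move=> xW gap; have := IHd (x |: W) (star G x); rewrite cardsU1C //.
  have -> : k - #|W|.+1 = d by lia.
  by apply; [|exact: uniform_star|exact: star_above|exact: meets_in_star| |].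
rewrite count_iotaS; case: (boolP (P #|W|)) => [PW|nPW]; last first.
  (* A forbidden [#|W|] differs from [a], so the gap survives in the stars. *)
  have gap : exists2 a, #|W| < a /\ P a & exists2 b, a < b < k & ~~ P b.
    exists a; last by exists b.
    by split=> //; rewrite ltn_neqAle leWa andbT; apply: contraNneq nPW => ->.
  have [->|[F0 F0G]] := set_0Vmem G; first by rewrite cards0.
  set c := k ^ d * _ * _ in bstar.
  apply: leq_trans
    (leq_card_bigcup (A := F0 :\: W) (H := star G) (b := c) _ _) _.
  - move=> F FG.
    have [x xF0 xF] := exists_common_outside uG sWG mG ltWk nPW F0G FG.
    by exists x => //; rewrite inE FG.
  - by move=> x /setDP[_ xW]; apply: bstar; rewrite ?inE.
  rewrite add0n expnS -!mulnA /c -mulnA leq_mul2r; apply/orP; right.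
  by rewrite -(uG _ F0G) subset_leq_card // subsetDl.
(* The allowed size [k.-1] is still counted, so the predecessor in the exponent really lowers it. *)
have count_gt0 : 0 < count P (iota #|W|.+1 d).
  rewrite -has_count; apply/hasP; exists k.-1 => //.
  by rewrite mem_iota; lia.
have exP : exists i, (#|W| < i) && P i by exists k.-1; rewrite Pk andbT; lia.
have [t /andP[ltWt Pt] min_t] := ex_minnP exP.
have letk : t <= k.-1 by apply: min_t; rewrite Pk andbT; lia.
(* With [t] the least allowed size above [#|W|], a forbidden size beyond [t] gives a gap inherited
   by the stars. *)
have [/allP P_tail | /allPn[j]] := boolP (all P (iota t (k - t))); last first.
  rewrite mem_iota => ltj nPj.
  have neq_tj : t != j by apply: contraNneq nPj => <-.
  have gap : exists2 a, #|W| < a /\ P a & exists2 b, a < b < k & ~~ P b.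
    by exists t => //; exists j => //; lia.
  have covC F : F \in G -> exists2 x, x \in ~: W & F \in star G x.
    move=> FG; have [x xW xF] := exists_outside uG FG ltWk.
    by exists x => //; rewrite inE FG.
  apply: leq_trans (leq_card_bigcup covC (fun x xW => bstar x xW gap)) _.
  rewrite add1n /= -[in X in _ <= X](prednK count_gt0) !expnS.
  rewrite -[k * _ * _]mulnA; set c := k ^ d * _.
  apply: leq_trans (leq_mul (max_card _) (leqnn _)) _.
  by rewrite mulnCA leq_mul2r leq_pmull ?orbT //; lia.
(* Beyond #|W| the sizes satisfying P are exactly t, ..., k.-1. *)
have ltbt : b < t.
  rewrite ltnNge; apply: contra nPb => letb; apply: P_tail.
  by rewrite mem_iota; lia.
(* Minimality of [t] forces [a] to be [#|W|], so [b] lies strictly between [#|W|] and [t]. *)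
have ltWt1 : #|W|.+1 < t.
  case: (ltngtP a #|W|) => [||eqa]; [by lia| move=> ltWa | by lia].
  have := min_t a; rewrite ltWa Pa; lia.
have -> : count P (iota #|W|.+1 d) = k - t.
  have -> : d = (t - #|W|.+1) + (k - t) by lia.
  rewrite iotaD count_cat subnKC //.
  rewrite (_ : count P (iota _ (t - _)) = 0) ?add0n; last first.
    apply/eqP; rewrite -leqn0 leqNgt -has_count; apply/hasP => -[i].
    by rewrite mem_iota => lti Pi; have := min_t i; rewrite Pi; lia.
  rewrite -[RHS](size_iota t); apply/eqP; rewrite -all_count.
  exact/allP.
rewrite add1n /=; apply: leq_trans (_ : gap_const k * #|T| ^ (k - t) <= _).
  apply: (isolated_intersection_bound uG sWG _ _); first by lia.
  move=> F1 F2 F1G F2G neF; have PI := mG _ _ F1G F2G neF.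
  have leWI : #|W| <= #|F1 :&: F2| by rewrite subset_leq_card // subsetI !sWG.
  have [//|neI /=] := eqVneq #|F1 :&: F2| #|W|.
  by apply: min_t; rewrite PI; lia.
by rewrite -mulnA leq_pmull // expn_gt0; lia.
Qed.

End Families.

(** * Comparison of powers with binomial coefficients *)

Lemma exp_le_ffact n k : k.*2 <= n -> n ^ k <= 2 ^ k * n ^_ k.
Proof.
elim: k => [|k IHk] le2kn //.
rewrite !expnS ffactnSr -mulnA.
(* The new factor of the falling factorial is at least half of [n], so twice it compensates for
   [n]. *)
rewrite [X in _ <= X](_ : _ = (n - k).*2 * (2 ^ k * n ^_ k)).
  by apply: leq_mul; [lia | apply: IHk; lia].
by rewrite -mul2n; move: (2 ^ k) (n ^_ k) => x y; lia.
Qed.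

(** Otherwise [n ^ k <= 2 ^ k * k! * 'C(n, k)] and [a + b <= k.-1] would give
    [n <= 2 ^ k * k! * C]. *)
Lemma small_product_lt_bin k C n a b :
  0 < k -> k.*2 + 2 ^ k * k`! * C < n ->
  a + b < k -> C * (n ^ a * n ^ b) < 'C(n, k).
Proof.
move=> k_gt0 ltn ltab; have n_gt0 : 0 < n by lia.
rewrite ltnNge; apply: contraL ltn => leC; rewrite -leqNgt.
have [le2kn|] := leqP k.*2 n; last by lia.
have := exp_le_ffact le2kn; rewrite -bin_ffact => le_nk.
have : n * n ^ k.-1 <= 2 ^ k * k`! * C * n ^ k.-1.
  rewrite -expnS prednK //; apply: leq_trans le_nk _.
  rewrite -!mulnA leq_mul2l mulnC leq_mul2l; apply/orP; right; apply/orP; right.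
  by apply: leq_trans leC _; rewrite -expnD leq_mul2l leq_pexp2l ?orbT //; lia.
rewrite leq_pmul2r ?expn_gt0 ?n_gt0 //; lia.
Qed.

(** * Cliques and cocliques of Johnson graphs as set families *)

Definition is_family (n k : nat) (P : pred nat) (G : {set {set 'I_n}}) :=
  uniform k G /\ meets_in P G.

Definition has_gap (k : nat) (P : pred nat) :=
  exists a b : 'I_k, [/\ a < b, P a & ~~ P b].

Section Johnson.

Variables (n k : nat) (L : {set 'I_k}).

(** Extends membership in [L] to all naturals in the form used by [johnson]. Its complement also
    holds from [k] on, but the bounds count sizes over [iota 0 k] only. *)
Definition sizes_in (i : nat) : bool := [exists l in L, i == val l].

Lemma sizes_in_ord (i : 'I_k) : sizes_in i = (i \in L).
Proof.
apply/existsP/idP => [[l /andP[lL /eqP/val_inj ->]] //|iL].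
by exists i; rewrite iL eqxx.
Qed.

Lemma omega_le b :
  (forall G : {set {set 'I_n}}, is_family k sizes_in G -> #|G| <= b) ->
  omega (johnson n k L) <= b.
Proof.
move=> leb; apply/bigmax_leqP => A /forallP clA.
rewrite -(card_imset _ val_inj); apply: leb; split.
  by move=> _ /imsetP[F _ ->]; apply/eqP/(valP F).
move=> _ _ /imsetP[F1 F1A ->] /imsetP[F2 F2A ->] neF.
have neF' : F1 != F2 by apply: contraNneq neF => ->.
have := clA F1; rewrite F1A /= => /forallP/(_ F2).
by rewrite F2A neF' /johnson neF'.
Qed.

Lemma alpha_le b :
  (forall G : {set {set 'I_n}}, is_family k (predC sizes_in) G -> #|G| <= b) ->
  alpha (johnson n k L) <= b.
Proof.
move=> leb; apply/bigmax_leqP => A /forallP clA.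
rewrite -(card_imset _ val_inj); apply: leb; split.
  by move=> _ /imsetP[F _ ->]; apply/eqP/(valP F).
move=> _ _ /imsetP[F1 F1A ->] /imsetP[F2 F2A ->] neF.
have neF' : F1 != F2 by apply: contraNneq neF => ->.
have := clA F1; rewrite F1A /= => /forallP/(_ F2).
by rewrite F2A neF' /johnson neF'.
Qed.

End Johnson.

(** * The bounds over the ground set ['I_n] and the conclusion *)

Lemma gap_families_bound (n k : nat) (P : pred nat) (G : {set {set 'I_n}}) :
    0 < k -> P k.-1 -> has_gap k P -> is_family k P G ->
  #|G| <= k ^ k * gap_const k * n ^ (count P (iota 0 k)).-1.
Proof.
move=> k_gt0 Pk [a [b [ltab Pa nPb]]] [uG mG].
have := @gap_bound _ k P G set0 uG (fun F _ => sub0set F) mG Pk.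
rewrite cards0 subn0 card_ord; apply.
by exists a => //; exists b => //; rewrite ltab /=.
Qed.

Lemma families_bound (n k : nat) (P : pred nat) (G : {set {set 'I_n}}) :
  is_family k P G -> #|G| <= k ^ k * n ^ count P (iota 0 k).
Proof.
case=> uG mG; have := family_bound uG (fun F _ => sub0set F) mG.
by rewrite cards0 subn0 card_ord.
Qed.

(** Take for [t] the least allowed size: any forbidden size above it exhibits a gap. *)
Lemma threshold_or_gap (k : nat) (P : pred nat) :
  0 < k -> P k.-1 ->
  (exists t, forall i : 'I_k, P i = (t <= i)) \/ has_gap k P.
Proof.
move=> k_gt0 Pk; have [t Pt min_t] := ex_minnP (ex_intro P _ Pk).
have [/forallP all_t|] := boolP [forall i : 'I_k, (t <= i) ==> P i].
  left; exists t => i; apply/idP/idP; first exact: min_t.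
  exact: (implyP (all_t i)).
rewrite negb_forall => /existsP[i]; rewrite negb_imply => /andP[leti nPi].
have ltt : t < i.
  by rewrite ltn_neqAle leti andbT; apply: contraNneq nPi => <-.
by right; exists (Ordinal (ltn_trans ltt (ltn_ord i))), i.
Qed.

Theorem theorem1 (k : nat) (k_gt0 : 0 < k) :
  exists n0 : nat, forall n : nat, n0 <= n ->
  forall L : {set 'I_k}, L != set0 -> L \proper [set: 'I_k] ->
  alpha (johnson n k L) * omega (johnson n k L) = 'C(n, k) ->
  exists t : nat,
    L = [set i : 'I_k | i < t] \/ ~: L = [set i : 'I_k | i < t].
Proof.
pose C := k ^ k * (k ^ k * gap_const k).
exists (k.*2 + 2 ^ k * k`! * C).+1 => n lt_n L _ _ eq_bin.
(* Stated for an unordered pair of bounds, since the gap may be on the clique side or on the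
   coclique side. *)
have no_gap x y a b : a + b < k ->
    x <= k ^ k * n ^ a -> y <= k ^ k * gap_const k * n ^ b -> x * y <> 'C(n, k).
  move=> ltab lex ley eqxy.
  have := small_product_lt_bin k_gt0 lt_n ltab.
  rewrite -eqxy ltnNge => /negP; apply; rewrite /C -mulnACA.
  exact: leq_mul lex ley.
have count_split : count (sizes_in L) (iota 0 k)
    + count (predC (sizes_in L)) (iota 0 k) = k.
  by rewrite count_predC size_iota.
have mem_last : k.-1 \in iota 0 k by rewrite mem_iota; lia.
(* The side containing [k.-1] is either a final segment, making the other side initial, or has a
   gap. In the latter case the two exponents add up to [k.-1]. *)
have [inL|ninL] := boolP (sizes_in L k.-1).
  have [[t eqt]|gap] := threshold_or_gap k_gt0 inL.
    exists t; right; apply/setP => i.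
    by rewrite !inE -sizes_in_ord eqt ltnNge.
  have count_gt0 : 0 < count (sizes_in L) (iota 0 k).
    by rewrite -has_count; apply/hasP; exists k.-1.
  have le_omega :=
    omega_le (fun G => gap_families_bound (n := n) k_gt0 inL gap (G := G)).
  have le_alpha := alpha_le (@families_bound n k (predC (sizes_in L))).
  have lt_k : count (predC (sizes_in L)) (iota 0 k)
      + (count (sizes_in L) (iota 0 k)).-1 < k by lia.
  by case: (no_gap _ _ _ _ lt_k le_alpha le_omega eq_bin).
have [[t eqt]|gap] := threshold_or_gap k_gt0 (ninL : predC (sizes_in L) k.-1).
  exists t; left; apply/setP => i.
  by rewrite !inE -sizes_in_ord ltnNge -eqt negbK.
have count_gt0 : 0 < count (predC (sizes_in L)) (iota 0 k).
  by rewrite -has_count; apply/hasP; exists k.-1.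
have le_omega := omega_le (@families_bound n k (sizes_in L)).
have le_alpha :=
  alpha_le (fun G => gap_families_bound (n := n) k_gt0 ninL gap (G := G)).
rewrite mulnC in eq_bin.
have lt_k : count (sizes_in L) (iota 0 k)
    + (count (predC (sizes_in L)) (iota 0 k)).-1 < k by lia.
by case: (no_gap _ _ _ _ lt_k le_omega le_alpha eq_bin).
Qed.
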